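(* Let $n \ge 3$ and $k \ge 1$ be integers and let $T_{n,k}$ be the tadpole graph. Then the F-index of the line graph of its subdivision graph is $F(L(S(T_{n,k}))) = 16n + 16k + 50$.
   Context: For a simple graph $H$, $d(u)$ denotes the degree of a vertex $u$ in $H$. The F-index of $H$ is $F(H) = \sum_{u \in V(H)} d^3(u) = \sum_{uv \in E(H)} [d^2(u)+d^2(v)]$. The subdivision graph $S(H)$ is the graph obtained from $H$ by inserting one additional vertex into each edge of $H$ (each edge is replaced by a path of length 2). The line graph $L(H)$ is the simple graph whose vertices are the edges of $H$, two distinct ones being adjacent when they share a common endpoint in $H$. The tadpole graph $T_{n,k}$ is obtained by joining a cycle $C_n$ on $n$ vertices to a path of length $k$, i.e. by identifying one end of a path with $k$ edges with a vertex of $C_n$; it has $n+k$ vertices and $n+k$ edges. *)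

(* Defs.v *)
From mathcomp Require Import all_boot.

Set Implicit Arguments.
Unset Strict Implicit.
Unset Printing Implicit Defensive.

Record sgraph := SGraph {
  vertex :> finType;
  adj : rel vertex;
  adj_sym : symmetric adj;
  adj_irr : irreflexive adj }.

Definition degree (G : sgraph) (u : G) : nat := #|[set v : G | adj u v]|.

Definition Findex (G : sgraph) : nat := \sum_(u : G) degree u ^ 3.

Definition edges (G : sgraph) : {set {set G}} :=
  [set [set u; v] | u in G, v in G & adj u v].

Notation edge G := {e : {set G} | e \in edges (G : sgraph)}.

Definition subdiv_adj (G : sgraph) : rel (G + edge G) := fun a b =>
  match a, b with
  | inl u, inr e | inr e, inl u => u \in val e
  | _, _ => false
  end.

Lemma subdiv_adj_sym (G : sgraph) : symmetric (@subdiv_adj G).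
Proof. by move=> [u|e] [v|f]. Qed.

Lemma subdiv_adj_irr (G : sgraph) : irreflexive (@subdiv_adj G).
Proof. by move=> [u|e]. Qed.

(* [inr e] is the additional vertex inserted into the edge [e]. *)
Definition subdivision (G : sgraph) : sgraph :=
  SGraph (@subdiv_adj_sym G) (@subdiv_adj_irr G).

Definition line_adj (G : sgraph) : rel (edge G) := fun e f =>
  (e != f) && (val e :&: val f != set0).

Lemma line_adj_sym (G : sgraph) : symmetric (@line_adj G).
Proof. by move=> e f; rewrite /line_adj eq_sym setIC. Qed.

Lemma line_adj_irr (G : sgraph) : irreflexive (@line_adj G).
Proof. by move=> e; rewrite /line_adj eqxx. Qed.

Definition line_graph (G : sgraph) : sgraph :=
  SGraph (@line_adj_sym G) (@line_adj_irr G).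

(* [inl i] is the vertex c_i of the cycle c_0, ..., c_(n-1), and [inr j] is the
   vertex p_(j+1) of the path p_0, ..., p_k; the end p_0 is identified with c_0.
   The test [i != j] only excludes the loop that would arise for n = 1. *)
Definition tadpole_adj (n k : nat) : rel ('I_n + 'I_k) := fun a b =>
  match a, b with
  | inl i, inl j => (i != j) && ((ordS i == j) || (ordS j == i))
  | inr i, inr j => (i.+1 == j :> nat) || (j.+1 == i :> nat)
  | inl i, inr j | inr j, inl i => (i == 0 :> nat) && (j == 0 :> nat)
  end.

Lemma tadpole_adj_sym (n k : nat) : symmetric (@tadpole_adj n k).
Proof.
by move=> [i|i] [j|j] //=; rewrite 1?[j == i]eq_sym orbC.
Qed.

Lemma tadpole_adj_irr (n k : nat) : irreflexive (@tadpole_adj n k).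
Proof. by move=> [i|i] /=; rewrite ?eqxx // orbb gtn_eqF. Qed.

Definition tadpole (n k : nat) : sgraph :=
  SGraph (@tadpole_adj_sym n k) (@tadpole_adj_irr n k).

(* Main.v *)
Require Import Defs.
From mathcomp Require Import all_boot zify.

Set Implicit Arguments.
Unset Strict Implicit.
Unset Printing Implicit Defensive.

(** In [L(H)] an edge [ab] of [H] meets [d(a) - 1] other edges at [a] and
    [d(b) - 1] at [b], hence has degree [d(a) + d(b) - 2] ([degree_line_graph]).
    When [H = S(G)], every edge joins an old vertex [u], of unchanged degree, to
    a new vertex, of degree 2, so its degree in [L(S(G))] is just [d(u)]
    ([degree_line_subdivision]).  Exactly [d(u)] edges of [S(G)] start at [u],
    and double counting the incidences gives, for every simple graph,
      [F(L(S(G))) = \sum_u d(u) * d(u)^3 = \sum_u d(u)^4]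
    ([Findex_line_subdivision]).

    In the tadpole the junction has degree 3, the free end of the path has
    degree 1, and the other [n + k - 2] vertices have degree 2, whence
    [81 + 1 + 16 (n + k - 2) = 16 n + 16 k + 50]. *)

Definition incident (G : sgraph) (u : G) : {set {set G}} :=
  [set e in edges G | u \in e].

Lemma edgesP (G : sgraph) (e : {set G}) :
  reflect (exists u v, adj u v /\ e = [set u; v]) (e \in edges G).
Proof.
apply: (iffP imset2P) => [[u v _]|[u [v [uv ->]]]].
  by rewrite inE => /andP[_ uv] ->; exists u, v.
by exists u v => //; rewrite inE uv.
Qed.

Lemma adj_neq (G : sgraph) (u v : G) : adj u v -> u != v.
Proof. by apply: contraTneq => ->; rewrite adj_irr. Qed.

Lemma card_edge (G : sgraph) (e : {set G}) : e \in edges G -> #|e| = 2.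
Proof. by case/edgesP=> u [v [uv ->]]; rewrite cards2 (adj_neq uv). Qed.

(** The edges at [u] correspond to the neighbours of [u], by [v |-> uv]. *)
Lemma card_incident (G : sgraph) (u : G) : #|incident u| = degree u.
Proof.
rewrite /degree -(@card_in_imset _ _ (fun v => [set u; v])); last first.
  move=> v w; rewrite !inE => uv uw /setP/(_ v).
  by rewrite !inE eqxx orbT eq_sym (negPf (adj_neq uv)) => /esym/eqP.
apply: eq_card => e; rewrite inE; apply/andP/imsetP.
  case=> /edgesP[a [b [ab ->]]]; rewrite !inE => /orP[]/eqP->.
    by exists b; rewrite ?inE.
  by exists a; rewrite ?inE 1?adj_sym // setUC.
case=> v; rewrite inE => uv ->; split; last by rewrite !inE eqxx.
by apply/edgesP; exists u, v.
Qed.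

Lemma card_edges_at (G : sgraph) (u : G) :
  #|[set e : edge G | u \in val e]| = degree u.
Proof.
rewrite -card_incident -(card_imset _ val_inj).
apply: eq_card => e; rewrite inE; apply/imsetP/andP.
  by case=> f; rewrite inE => uf ->; split=> //; exact: valP.
by case=> eE ue; exists (exist _ e eE); rewrite ?inE.
Qed.

(** An edge has only two elements, so one containing [a] and [b] is [ab]. *)
Lemma incidentI (G : sgraph) (a b : G) :
  adj a b -> incident a :&: incident b = [set [set a; b]].
Proof.
move=> ab; apply/setP=> e; rewrite !inE; apply/idP/eqP.
  case/andP=> /andP[eE ae] /andP[_ be]; apply/esym/eqP.
  by rewrite eqEcard subUset !sub1set ae be (card_edge eE) cards2 (adj_neq ab).
move=> ->; have -> : [set a; b] \in edges G by apply/edgesP; exists a, b.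
by rewrite !inE !eqxx orbT.
Qed.

(** The neighbours of [ab] form [incident a :|: incident b] without [ab]
    itself, which is also the single edge counted twice in the union. *)
Lemma degree_line_graph (G : sgraph) (e : line_graph G) (a b : G) :
  adj a b -> val e = [set a; b] -> degree e = degree a + degree b - 2.
Proof.
move=> ab eab.
have nbh : val @: [set f : line_graph G | adj e f]
           = (incident a :|: incident b) :\ [set a; b].
  apply/setP=> x; rewrite !inE; apply/imsetP/idP.
    case=> f; rewrite inE /= /line_adj => /andP[ef /set0Pn[c]].
    rewrite eab inE => /andP[cab cf] ->.
    rewrite -eab eq_sym (inj_eq val_inj) ef (valP f) /=.
    by move: cab; rewrite !inE => /orP[]/eqP <-; rewrite cf ?orbT.
  case/andP=> xab /orP xI.
  have xE : x \in edges G by case: xI => /andP[].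
  exists (exist _ x xE) => //; rewrite inE /= /line_adj; apply/andP; split.
    by rewrite -(inj_eq val_inj) eab eq_sym.
  apply/set0Pn; rewrite eab.
  by case: xI => /andP[_ cx]; [exists a | exists b];
    rewrite !inE /= eqxx ?orbT cx.
have := cardsUI (incident a) (incident b).
have /setIidPr : [set [set a; b]] \subset incident a :|: incident b.
  by rewrite -incidentI // (subset_trans (subsetIl _ _)) ?subsetUl.
rewrite incidentI // cards1 !card_incident => sub cardU.
rewrite {1}/degree -(card_imset _ val_inj) nbh cardsD sub cards1.
by rewrite -cardU (subnDr 1 _ 1).
Qed.

Lemma degree_old (G : sgraph) (u : G) :
  degree (inl u : subdivision G) = degree u.
Proof.
have nbh : [set a : subdivision G | adj (inl u : subdivision G) a]
           = inr @: [set e : edge G | u \in val e].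
  apply/setP=> -[v|e]; rewrite inE /=; apply/esym.
    by apply/imsetP=> -[].
  by rewrite mem_imset ?inE // => ? ? [].
rewrite {1}/degree nbh card_imset; last by move=> ? ? [].
exact: card_edges_at.
Qed.

Lemma degree_new (G : sgraph) (e : edge G) :
  degree (inr e : subdivision G) = 2.
Proof.
rewrite -(card_edge (valP e)) -(card_imset (mem (val e)) (@inl_inj G (edge G))).
rewrite /degree; apply: eq_card => -[v|f]; rewrite inE /=; apply/esym.
  by rewrite mem_imset //; exact: inl_inj.
by apply/imsetP=> -[].
Qed.

Lemma edge_subdivisionP (G : sgraph) (x : {set subdivision G}) :
  x \in edges (subdivision G) ->
  exists u e, adj (inl u : subdivision G) (inr e) /\ x = [set inl u; inr e].
Proof.
case/edgesP=> -[u|e] [[v|f] [//= xE ->]]; first by exists u, f.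
by exists v, e; split; rewrite // setUC.
Qed.

(** Here [degree u] is taken in [G]: the endpoint of degree 2 contributes
    exactly the amount subtracted in [degree_line_graph]. *)
Lemma degree_line_subdivision (G : sgraph)
    (x : line_graph (subdivision G)) (u : G) :
  inl u \in val x -> degree x = degree u.
Proof.
have [v [e [ve xE]]] := edge_subdivisionP (valP x).
rewrite xE !inE orbF => /eqP[->].
by rewrite (degree_line_graph ve xE) degree_old degree_new addnK.
Qed.

(** The sum over edges of [S(G)] is turned into a sum over old vertices by
    exchanging the summations over incident pairs (old vertex, edge). *)
Lemma Findex_line_subdivision (G : sgraph) :
  Findex (line_graph (subdivision G)) = \sum_(u : G) degree u ^ 4.
Proof.
transitivity (\sum_(x : line_graph (subdivision G))
                \sum_(u : G | inl u \in val x) degree u ^ 3).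
  apply: eq_bigr => x _.
  (* each edge of the subdivision has exactly one old endpoint *)
  have [v [e [ve xE]]] := edge_subdivisionP (valP x).
  rewrite (big_pred1 v) => [|u]; last by rewrite xE !inE orbF.
  by rewrite (degree_line_subdivision (u := v)) // xE !inE eqxx.
rewrite (exchange_big_dep predT) //=; apply: eq_bigr => u _.
rewrite sum_nat_const (expnS _ 3); congr (_ * _).
by rewrite -[RHS]degree_old -card_edges_at cardsE.
Qed.

Lemma degree_sum (G : sgraph) (u : G) : degree u = \sum_(v : G) adj u v.
Proof. by rewrite /degree -sum1dep_card big_mkcond. Qed.

Lemma sum_ord_eq (m a : nat) : \sum_(i < m) (i == a :> nat) = (a < m).
Proof.
case: (ltnP a m) => am.
  rewrite (bigD1 (Ordinal am)) //= eqxx big1 // => i.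
  by rewrite -val_eqE /= => /negPf->.
by rewrite big1 // => i _; rewrite ltn_eqF // (leq_trans (ltn_ord i)).
Qed.

Lemma modn_succ (n a : nat) :
  a < n -> a.+1 %% n = if a.+1 == n then 0 else a.+1.
Proof.
rewrite leq_eqVlt; case: eqP => [->|_] /=; first by rewrite modnn.
exact: modn_small.
Qed.

(** The successor and the predecessor on the cycle are distinct neighbours
    because [3 <= n]; the junction [c_0] has the further neighbour [p_1]. *)
Lemma degree_cycle (n k : nat) (i : 'I_n) : 3 <= n -> 1 <= k ->
  degree (inl i : tadpole n k) = 2 + (i == 0 :> nat).
Proof.
move=> n3 k1; rewrite degree_sum big_sumType /=; congr (_ + _).
  rewrite (eq_bigr (fun j : 'I_n =>
             (j == ordS i :> nat) + (j == ord_pred i :> nat))).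
    by rewrite big_split /= !sum_ord_eq !ltn_pmod //; lia.
  move=> j _; rewrite -!val_eqE /= !modn_succ //.
  have -> : (i + n).-1 %% n = if i == 0 :> nat then n.-1 else i.-1.
    case: (nat_of_ord i) (ltn_ord i) => [|a] an /=.
      by rewrite modn_small //; lia.
    by rewrite modnDr modn_small // ltnW.
  move: (ltn_ord i) (ltn_ord j); move: (nat_of_ord i) (nat_of_ord j) => a b.
  by case: (a.+1 =P n); case: (b.+1 =P n); case: (a =P 0); lia.
by case: eqP => _ /=; [rewrite sum_ord_eq k1 | rewrite big1].
Qed.

(** Every [p_(j+1)] has a neighbour behind it: [p_j], or the junction when
    [j = 0].  Only the free end [j.+1 = k] has none ahead. *)
Lemma degree_path (n k : nat) (j : 'I_k) : 0 < n ->
  degree (inr j : tadpole n k) = 1 + (j.+1 < k).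
Proof.
move=> n1; rewrite degree_sum big_sumType /=.
have -> : \sum_(i < n) ((i == 0 :> nat) && (j == 0 :> nat)) = (j == 0 :> nat).
  case: (j == 0 :> nat); last by rewrite big1 // => i _; rewrite andbF.
  by under eq_bigr do rewrite andbT; rewrite sum_ord_eq n1.
have -> : \sum_(i < k) ((j.+1 == i) || (i.+1 == j :> nat))
          = (j.+1 < k) + (0 < j).
  (* the factor cancels [j.-1] when [j = 0]: the neighbour behind is then the
     junction, outside this sum *)
  rewrite (eq_bigr (fun i : 'I_k =>
             (i == j.+1 :> nat) + (0 < j) * (i == j.-1 :> nat))).
    rewrite big_split -big_distrr /= !sum_ord_eq.
    by rewrite (leq_ltn_trans (leq_pred j) (ltn_ord j)) muln1.
  by move=> i _; lia.
lia.
Qed.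

Theorem theorem5 (n k : nat) (hn : 3 <= n) (hk : 1 <= k) :
  Findex (line_graph (subdivision (tadpole n k))) = 16 * n + 16 * k + 50.
Proof.
rewrite Findex_line_subdivision big_sumType /=.
(* a degree 2 contributes 16; the junction adds 81 - 16 = 65, and the free end
   loses 16 - 1 = 15 *)
rewrite (eq_bigr (fun i : 'I_n => 16 + 65 * (i == 0 :> nat))); last first.
  by move=> i _; rewrite degree_cycle //; case: (_ == _).
rewrite [X in _ + X](eq_bigr (fun j : 'I_k => 16 - 15 * (j == k.-1 :> nat))).
  rewrite big_split /= sumnB; last by move=> j _; case: (_ == _).
  rewrite -!big_distrr /= !sum_ord_eq !sum_nat_const !card_ord.
  by rewrite prednK // leqnn (leq_trans _ hn) //; lia.
move=> j _; rewrite degree_path ?(leq_trans _ hn) //.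
have -> : (j.+1 < k) = (j != k.-1 :> nat) by have := ltn_ord j; lia.
by case: (_ == _).
Qed.
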